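(* Let $\lambda$ be a nonzero real number and let $r\ge 0$ be an integer. For every integer $k\ge 0$, as formal power series in $t$, $$\frac{1}{\lambda^{k}}\frac{1}{k!}\big(e^{\lambda t}-1\big)^{k}e^{rt}=\sum_{n=k}^{\infty}{n+r \brace k+r}_{r,\lambda}\frac{t^{n}}{n!}.$$
   Context: For a nonzero real $\lambda$, the generalized falling factorials are $(x)_{0,\lambda}=1$ and $(x)_{n,\lambda}=x(x-\lambda)\cdots(x-(n-1)\lambda)$ for $n\ge 1$. For an integer $r\ge 0$, the $\lambda$-analogues of $r$-Stirling numbers of the second kind ${n+r \brace k+r}_{r,\lambda}$ ($0\le k\le n$) are the real numbers uniquely determined by the polynomial identities in $x$ $$(x+r)^{n}=\sum_{k=0}^{n}{n+r \brace k+r}_{r,\lambda}(x)_{k,\lambda},\quad n\ge 0.$$ *)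

(* Defs.v *)
From HB Require Import structures.
From mathcomp Require Import all_boot all_order all_algebra.
From mathcomp Require Import boolp reals.

Set Implicit Arguments.
Unset Strict Implicit.
Unset Printing Implicit Defensive.

Import Order.TTheory GRing.Theory Num.Theory.
Local Open Scope ring_scope.

(* A record rather than an alias of nat -> R: the latter already carries the
   pointwise product, which is not the product of power series. *)
Record fps (R : Type) := FPS { fcoef : nat -> R }.

Lemma fpsP (R : Type) (f g : fps R) : fcoef f =1 fcoef g -> f = g.
Proof. by case: f g => f [g] /= fg; congr FPS; apply/funext. Qed.

HB.instance Definition _ (R : Type) := gen_eqMixin (fps R).
HB.instance Definition _ (R : Type) := gen_choiceMixin (fps R).

Section FpsRing.
Variable R : comNzRingType.
Implicit Types f g h : fps R.

Definition fps_zero : fps R := FPS (fun _ => 0).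
Definition fps_opp f : fps R := FPS (fun n => - fcoef f n).
Definition fps_add f g : fps R := FPS (fun n => fcoef f n + fcoef g n).
Definition fps_one : fps R := FPS (fun n => (n == 0)%:R).
Definition fps_mul f g : fps R :=
  FPS (fun n => \sum_(i < n.+1) fcoef f i * fcoef g (n - i)).
Definition fps_scale (a : R) f : fps R := FPS (fun n => a * fcoef f n).

Fact fps_addA : associative fps_add.
Proof. by move=> f g h; apply: fpsP => n /=; rewrite addrA. Qed.
Fact fps_addC : commutative fps_add.
Proof. by move=> f g; apply: fpsP => n /=; rewrite addrC. Qed.
Fact fps_add0 : left_id fps_zero fps_add.
Proof. by move=> f; apply: fpsP => n /=; rewrite add0r. Qed.
Fact fps_addN : left_inverse fps_zero fps_opp fps_add.
Proof. by move=> f; apply: fpsP => n /=; rewrite addNr. Qed.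

HB.instance Definition _ :=
  GRing.isZmodule.Build (fps R) fps_addA fps_addC fps_add0 fps_addN.

Let trunc N f : {poly R} := \poly_(i < N) fcoef f i.

Let coef_trunc N f i : (i < N)%N -> (trunc N f)`_i = fcoef f i.
Proof. by move=> iN; rewrite coef_poly iN. Qed.

Let coef_trunc_mul N f g i : (i < N)%N ->
  fcoef (fps_mul f g) i = (trunc N f * trunc N g)`_i.
Proof.
move=> iN; rewrite coefM /=; apply: eq_bigr => -[j /= ji] _.
by rewrite !coef_trunc // (leq_ltn_trans _ iN) // leq_subr.
Qed.

Fact fps_mulA : associative fps_mul.
Proof.
move=> f g h; apply: fpsP => n.
transitivity ((trunc n.+1 f * (trunc n.+1 g * trunc n.+1 h))`_n).
  rewrite coefM /=; apply: eq_bigr => -[j /= ji] _.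
  by rewrite coef_trunc // -(@coef_trunc_mul n.+1) // ltnS leq_subr.
rewrite mulrA coefM /=; apply: eq_bigr => -[j /= ji] _.
by rewrite coef_trunc ?ltnS ?leq_subr // -(@coef_trunc_mul n.+1).
Qed.

Fact fps_mulC : commutative fps_mul.
Proof.
by move=> f g; apply: fpsP => n; rewrite !(@coef_trunc_mul n.+1) // mulrC.
Qed.

Fact fps_mul1 : left_id fps_one fps_mul.
Proof.
move=> f; apply: fpsP => n /=; rewrite big_ord_recl /= subn0 mul1r.
by rewrite big1 ?addr0 // => i _; rewrite mul0r.
Qed.

Fact fps_mulDl : left_distributive fps_mul fps_add.
Proof.
move=> f g h; apply: fpsP => n /=; rewrite -big_split /=.
by apply: eq_bigr => i _; rewrite mulrDl.
Qed.

Fact fps_one_neq0 : fps_one != 0.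
Proof.
by apply/eqP => /(congr1 (fun f => fcoef f 0)) /= /eqP; rewrite oner_eq0.
Qed.

HB.instance Definition _ := GRing.Zmodule_isComNzRing.Build (fps R)
  fps_mulA fps_mulC fps_mul1 fps_mulDl fps_one_neq0.

Fact fps_scaleA a b f :
  fps_scale a (fps_scale b f) = fps_scale (a * b) f.
Proof. by apply: fpsP => n /=; rewrite mulrA. Qed.
Fact fps_scale1 : left_id 1 fps_scale.
Proof. by move=> f; apply: fpsP => n /=; rewrite mul1r. Qed.
Fact fps_scaleDr : right_distributive fps_scale +%R.
Proof. by move=> a f g; apply: fpsP => n /=; rewrite mulrDr. Qed.
Fact fps_scaleDl f : {morph fps_scale^~ f : a b / a + b}.
Proof. by move=> a b; apply: fpsP => n /=; rewrite mulrDl. Qed.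

HB.instance Definition _ := GRing.Zmodule_isLmodule.Build R (fps R)
  fps_scaleA fps_scale1 fps_scaleDr fps_scaleDl.

Fact fps_scaleAl (a : R) f g : a *: (f * g) = (a *: f) * g.
Proof.
apply: fpsP => n /=; rewrite mulr_sumr.
by apply: eq_bigr => i _; rewrite mulrA.
Qed.

HB.instance Definition _ :=
  GRing.Lmodule_isLalgebra.Build R (fps R) fps_scaleAl.
HB.instance Definition _ := GRing.Lalgebra_isComAlgebra.Build R (fps R).

End FpsRing.

(* The formal power series e^(a t). *)
Definition expfps (R : fieldType) (a : R) : fps R :=
  FPS (fun n => a ^+ n / n`!%:R).

Section LambdaStirling.
Variable R : comNzRingType.
Implicit Types (lambda : R) (p : {poly R}) (S : nat -> nat -> R).

(* (x)_{n,lambda}, as a polynomial in x. *)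
Definition gffact lambda (n : nat) : {poly R} :=
  \prod_(i < n) ('X - (i%:R * lambda)%:P).

(* S n k stands for {n+r brace k+r}_{r,lambda}; nothing is required of S n k
   when n < k. *)
Definition is_lambda_rstirling2 lambda (r : nat) S : Prop :=
  forall n : nat,
    ('X + r%:R%:P) ^+ n = \sum_(k < n.+1) S n k *: gffact lambda k.

Lemma gffact_monic lambda n : gffact lambda n \is monic.
Proof. exact: monic_prod_XsubC. Qed.

Lemma size_gffact lambda n : size (gffact lambda n) = n.+1.
Proof. by rewrite size_prod_XsubC /index_enum -enumT size_enum_ord. Qed.

Lemma coef_gffact lambda n : (gffact lambda n)`_n = 1.
Proof. by have /monicP := gffact_monic lambda n; rewrite /lead_coef size_gffact. Qed.

Lemma gffact_span lambda n p : (size p <= n)%N ->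
  exists c : nat -> R, p = \sum_(k < n) c k *: gffact lambda k.
Proof.
elim: n p => [|n IHn] p sp.
  exists (fun=> 0); rewrite big_ord0; apply/eqP.
  by rewrite -size_poly_leq0.
have /IHn[c pE] : (size (p - p`_n *: gffact lambda n)%R <= n)%N.
  apply/leq_sizeP => j; rewrite leq_eqVlt => /predU1P[<-|nj].
    by rewrite coefB coefZ coef_gffact mulr1 subrr.
  rewrite coefB coefZ (nth_default _ (leq_trans sp nj)).
  by rewrite [_`_j]nth_default ?size_gffact // mulr0 subr0.
exists (fun k => if (k < n)%N then c k else p`_n).
rewrite big_ord_recr /= ltnn -[LHS](subrK (p`_n *: gffact lambda n)) pE.
by congr (_ + _); apply: eq_bigr => i _; rewrite ltn_ord.
Qed.

Lemma gffact_free lambda n (c : nat -> R) :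
  \sum_(k < n) c k *: gffact lambda k = 0 ->
  forall k, (k < n)%N -> c k = 0.
Proof.
elim: n => [//|n IHn]; rewrite big_ord_recr /= => eq0.
have cn0 : c n = 0.
  have /(congr1 (fun p : {poly R} => p`_n)) := eq0.
  rewrite coefD coef_sum coefZ coef_gffact mulr1 coef0 big1 ?add0r //.
  by move=> i _; rewrite coefZ nth_default ?mulr0 // size_gffact.
move: eq0; rewrite cn0 scale0r addr0 => /IHn cE k.
by rewrite ltnS leq_eqVlt => /predU1P[->|/cE].
Qed.

Lemma lambda_rstirling2_exists lambda r :
  exists S, is_lambda_rstirling2 lambda r S.
Proof.
have /choice[S SE] : forall n, exists c : nat -> R,
    ('X + r%:R%:P) ^+ n = \sum_(k < n.+1) c k *: gffact lambda k.
  move=> n; apply: gffact_span.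
  by rewrite -[r%:R%:P]opprK -polyCN size_exp_XsubC.
by exists S.
Qed.

Lemma lambda_rstirling2_unique lambda r S S' :
  is_lambda_rstirling2 lambda r S -> is_lambda_rstirling2 lambda r S' ->
  forall n k, (k <= n)%N -> S n k = S' n k.
Proof.
move=> SE S'E n k kn; apply/eqP; rewrite -subr_eq0; apply/eqP.
apply: (@gffact_free lambda n.+1 (fun k => S n k - S' n k)) => //.
under eq_bigr do rewrite scalerBl.
by rewrite sumrB -SE -S'E subrr.
Qed.

(* lambda_rstirling2 lambda r n k is {n+r brace k+r}_{r,lambda}: the indices
   are not shifted by r. It is meaningful only for k <= n. *)
Definition lambda_rstirling2 lambda (r : nat) : nat -> nat -> R :=
  sval (cid (lambda_rstirling2_exists lambda r)).

Lemma lambda_rstirling2P lambda r :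
  is_lambda_rstirling2 lambda r (lambda_rstirling2 lambda r).
Proof. by rewrite /lambda_rstirling2; case: cid. Qed.

End LambdaStirling.

(* Main.v *)
Require Import Defs.
From HB Require Import structures.
From mathcomp Require Import all_boot all_order all_algebra.
From mathcomp Require Import boolp reals.
From mathcomp Require Import ring.

(* Let F_k be the left-hand side. Since (e^(lambda t) - 1)' =
   lambda (e^(lambda t) - 1) + lambda, differentiating gives
   F_(k+1)' = F_k + ((k+1) lambda + r) F_(k+1).  Hence T n k := n! [t^n] F_k
   satisfies T (n+1) (k+1) = T n k + ((k+1) lambda + r) T n (k+1), which is the
   recurrence obtained from multiplying (x+r)^n by
   x + r = (x - k lambda) + (k lambda + r).  So T satisfies the identities
   that determine the lambda-analogues of the r-Stirling numbers. *)

Set Implicit Arguments.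
Unset Strict Implicit.
Unset Printing Implicit Defensive.

Import Order.TTheory GRing.Theory Num.Theory.
Local Open Scope ring_scope.

Lemma natr_fact_neq0 (R : numDomainType) n : n`!%:R != 0 :> R.
Proof. by rewrite pnatr_eq0 -lt0n fact_gt0. Qed.

Section FpsDerivative.
Variable R : comNzRingType.
Implicit Types f g : fps R.

Definition fps_deriv f : fps R := FPS (fun n => n.+1%:R * fcoef f n.+1).

Lemma fps_derivD f g : fps_deriv (f + g) = fps_deriv f + fps_deriv g.
Proof. by apply: fpsP => n /=; rewrite mulrDr. Qed.

Lemma fps_derivN f : fps_deriv (- f) = - fps_deriv f.
Proof. by apply: fpsP => n /=; rewrite mulrN. Qed.

Lemma fps_derivZ a f : fps_deriv (a *: f) = a *: fps_deriv f.
Proof. by apply: fpsP => n /=; rewrite mulrCA. Qed.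

Lemma fps_deriv1 : fps_deriv 1 = 0.
Proof. by apply: fpsP => n /=; rewrite mulr0. Qed.

(** In the coefficient of degree [n.+1], the factor [n.+1] is split as [i + (n.+1 - i)] on each
    term; the end terms [i = 0] and [i = n.+1] then vanish in one sum each. *)
Lemma fps_derivM f g : fps_deriv (f * g) = fps_deriv f * g + f * fps_deriv g.
Proof.
apply: fpsP => n /=; rewrite mulr_sumr.
transitivity (\sum_(i < n.+2) (i%:R * fcoef f i) * fcoef g (n.+1 - i)
   + \sum_(i < n.+2) fcoef f i * ((n.+1 - i)%:R * fcoef g (n.+1 - i))).
  rewrite -big_split /=; apply: eq_bigr => -[i /= ilt] _.
  by rewrite natrB //; ring.
congr (_ + _).
  by rewrite big_ord_recl /= !mul0r add0r.
rewrite big_ord_recr /= subnn mul0r mulr0 addr0.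
by apply: eq_bigr => -[i /= ilt] _; rewrite subSn.
Qed.

(** At [n = 0] the truncated [n.-1] is harmless, since [*+ 0] kills the term. *)
Lemma fps_derivX f n : fps_deriv (f ^+ n) = f ^+ n.-1 * fps_deriv f *+ n.
Proof.
elim: n => [|[|n] IHn]; first by rewrite expr0 fps_deriv1.
  by rewrite expr1 mul1r.
by rewrite exprS fps_derivM IHn /= [in RHS]mulrS exprS; ring.
Qed.

End FpsDerivative.

Lemma fps_deriv_exp (R : numFieldType) (a : R) :
  fps_deriv (expfps a) = a *: expfps a.
Proof.
apply: fpsP => n /=; rewrite factS natrM exprS.
by field; rewrite natr_fact_neq0 nat1r pnatr_eq0.
Qed.

Lemma gffactS (R : comNzRingType) (lambda : R) n :
  gffact lambda n.+1 = gffact lambda n * ('X - (n%:R * lambda)%:P).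
Proof. exact: big_ord_recr. Qed.

Section RStirlingGenerating.
Variables (R : numFieldType) (lambda : R) (r : nat).
Hypothesis lambda_neq0 : lambda != 0.

Definition rstirling2_egf (k : nat) : fps R :=
  ((lambda ^+ k)^-1 * (k`!%:R)^-1)
    *: ((expfps lambda - 1) ^+ k * expfps (r%:R : R)).

Lemma rstirling2_egf0 : rstirling2_egf 0 = expfps r%:R.
Proof. by rewrite /rstirling2_egf !expr0 fact0 !invr1 mulr1 scale1r mul1r. Qed.

Lemma fps_deriv_rstirling2_egf k :
  fps_deriv (rstirling2_egf k.+1) =
  rstirling2_egf k + (k.+1%:R * lambda + r%:R) *: rstirling2_egf k.+1.
Proof.
have k1 : k.+1%:R != 0 :> R by rewrite pnatr_eq0.
rewrite /rstirling2_egf fps_derivZ fps_derivM fps_derivX /= fps_derivD.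
rewrite fps_derivN fps_deriv1 subr0 !fps_deriv_exp.
set G := expfps r%:R; set c := _^-1 * _^-1; set d := _^-1 * _^-1.
(* [c] and [d] are the normalising constants at [k.+1] and [k]; their ratio absorbs the factors
   produced by differentiating the power. *)
have -> : d = k.+1%:R * lambda * c.
  rewrite /c /d factS natrM exprS.
  by rewrite !invfM; field; rewrite natr_fact_neq0 nat1r k1 expf_neq0.
set E := expfps lambda - 1.
(* This splits the derivative of [E ^+ k.+1] into a multiple of [E ^+ k.+1] and a multiple of
   [E ^+ k]; the latter yields the [rstirling2_egf k] term. *)
have -> : expfps lambda = E + 1 by rewrite subrK.
rewrite -scaler_nat -!scalerAr -!scalerAl mulrDr mulr1 -exprSr.
rewrite mulrDl !scalerDr !scalerA.
by rewrite mulrDl scalerDl ![c * _]mulrC addrCA addrA.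
Qed.

Definition rstirling2_egf_coef (n k : nat) : R :=
  n`!%:R * fcoef (rstirling2_egf k) n.

Let T := rstirling2_egf_coef.

Lemma rstirling2_egf_coef0 n : T n 0 = r%:R ^+ n.
Proof.
rewrite /T /rstirling2_egf_coef rstirling2_egf0 /= mulrCA mulfV ?mulr1 //.
exact: natr_fact_neq0.
Qed.

(** This is the differential equation read at degree [n] and multiplied by
    [n]![, which turns the factor]n.+1[of the derivative into](n.+1)[!]. *)
Lemma rstirling2_egf_coefSS n k :
  T n.+1 k.+1 = T n k + (k.+1%:R * lambda + r%:R) * T n k.+1.
Proof.
transitivity (n`!%:R * fcoef (fps_deriv (rstirling2_egf k.+1)) n).
  by rewrite /T /rstirling2_egf_coef factS natrM -mulrA mulrCA.
rewrite fps_deriv_rstirling2_egf.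
rewrite -[fcoef _ n]/(fcoef (rstirling2_egf k) n
  + (k.+1%:R * lambda + r%:R) * fcoef (rstirling2_egf k.+1) n).
by rewrite mulrDr [X in _ + X]mulrCA.
Qed.

(** The recurrence propagates the vanishing from [n = 0], where it holds because [expfps lambda - 1]
    has zero constant term. *)
Lemma rstirling2_egf_coef_gt n k : (n < k)%N -> T n k = 0.
Proof.
elim: n k => [|n IHn] [|k] // nk; last first.
  by rewrite rstirling2_egf_coefSS !IHn ?mulr0 ?addr0 // ltnW.
have E0 : fcoef ((expfps lambda - 1) ^+ k.+1 * expfps r%:R) 0 = 0.
  by rewrite exprS -mulrA [LHS]big_ord1 /= expr0 divr1 subrr mul0r.
rewrite /T /rstirling2_egf_coef.
rewrite -[fcoef _ 0]/(_ * fcoef ((expfps lambda - 1) ^+ k.+1 * _) 0).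
by rewrite E0 !mulr0.
Qed.

Lemma rstirling2_egf_coefP : is_lambda_rstirling2 lambda r T.
Proof.
elim=> [|n IHn].
  by rewrite big_ord1 rstirling2_egf_coef0 !expr0 scale1r /gffact big_ord0.
rewrite exprS IHn mulr_sumr.
(* The second sum may run up to [k = n.+1] because [T n n.+1 = 0]; once its [k = 0] term is split
   off, both sums have the same range. *)
transitivity (\sum_(k < n.+1) T n k *: gffact lambda k.+1
   + \sum_(k < n.+2) ((k%:R * lambda + r%:R) * T n k) *: gffact lambda k).
  rewrite [X in _ = _ + X]big_ord_recr /= rstirling2_egf_coef_gt // mulr0 scale0r.
  rewrite addr0 -big_split /=; apply: eq_bigr => k _.
  rewrite gffactS -!mul_polyC !(polyCM, polyCD).
  by ring.
rewrite [X in _ + X = _]big_ord_recl [RHS]big_ord_recl /= mul0r add0r addrCA.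
rewrite !rstirling2_egf_coef0 -exprS; congr (_ + _).
rewrite -big_split /=; apply: eq_bigr => k _.
by rewrite rstirling2_egf_coefSS scalerDl.
Qed.

End RStirlingGenerating.

Theorem theorem1 (R : realType) (lambda : R) (hlambda : lambda != 0)
    (r k : nat) :
  ((lambda ^+ k)^-1 * (k`!%:R)^-1)
      *: ((expfps lambda - 1) ^+ k * expfps (r%:R : R))
  = FPS (fun n : nat =>
      if (k <= n)%N then lambda_rstirling2 lambda r n k / n`!%:R else 0).
Proof.
rewrite -/(rstirling2_egf lambda r k); apply: fpsP => n.
have -> : fcoef (rstirling2_egf lambda r k) n =
          rstirling2_egf_coef lambda r n k / n`!%:R.
  by rewrite /rstirling2_egf_coef mulrC mulKf ?natr_fact_neq0.
(* Uniqueness determines the Stirling numbers only for [k <= n]; for [n < k] the left-hand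
   coefficient itself vanishes. *)
rewrite [RHS]/=; case: leqP => [kn|nk].
  congr (_ / _); apply: lambda_rstirling2_unique kn.
    exact: rstirling2_egf_coefP.
  exact: lambda_rstirling2P.
by rewrite rstirling2_egf_coef_gt // mul0r.
Qed.
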